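(* Let $m,n$ be positive integers such that $1\leq m\leq 4$ and $m\leq n$. If $f\in\mathcal{W}_{n}$ and $g\in\mathcal{H}_{m}$, then $f\bullet g\subset\mathcal{H}_{m}$.
   Context: For an integer $k\ge 0$, $\mathbb{R}_k^+$ denotes the set of real polynomials $s\mapsto c_0+c_1s+\ldots+c_ks^k$ with all $c_i>0$ ($i=0,\ldots,k$). For $k\ge 1$, $\mathcal{H}_k$ is the set of $f\in\mathbb{R}_k^+$ all of whose complex zeros have negative real part (Hurwitz stable polynomials). For $k\ge 3$ and $f(s)=a_0+a_1s+\ldots+a_ks^k\in\mathbb{R}_k^+$ put $\lambda_i(f)=\dfrac{a_{i-2}a_{i+1}}{a_ia_{i-1}}$ for $i=2,\ldots,k-1$, and let $\mathcal{W}_k=\{f\in\mathbb{R}_k^+:\lambda_i(f)<1\ (i=2,\ldots,k-1)\}$. By definition $\mathcal{W}_k=\mathcal{H}_k$ for $k=1,2$. For $f(s)=\sum_{i=0}^n a_is^i\in\mathbb{R}_n^+$ and $g(s)=\sum_{i=0}^m b_is^i\in\mathbb{R}_m^+$ with $m\le n$, the generalized Hadamard product of $f$ and $g$ is the set $f\bullet g=\{F_0,\ldots,F_{n-m}\}$, where $F_j(s)=\sum_{i=0}^m a_{j+i}b_is^i$ for $j=0,\ldots,n-m$. *)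

(* Defs.v *)
From mathcomp Require Import all_boot all_order all_algebra.
From mathcomp Require Import complex.
From mathcomp Require Import classical_sets reals.

Set Implicit Arguments.
Unset Strict Implicit.
Unset Printing Implicit Defensive.

Import GRing.Theory Num.Theory.

Local Open Scope classical_set_scope.
Local Open Scope ring_scope.

Definition pos_poly {R : realType} (k : nat) : set {poly R} :=
  [set f | size f = k.+1 /\ forall i, (i <= k)%N -> 0 < f`_i].

(* complex.Re z is an element of R, whereas 'Re z is one of R[i]. *)
Definition hurwitz {R : realType} (k : nat) : set {poly R} :=
  [set f | pos_poly k f /\
    forall z : R[i], root (map_poly (real_complex R) f) z -> complex.Re z < 0].

(* Meaningful for i >= 2 only, where the subtractions do not truncate. *)
Definition lambda {R : realType} (i : nat) (f : {poly R}) : R :=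
  (f`_(i - 2) * f`_(i + 1)) / (f`_i * f`_(i - 1)).

(* For k = 1, 2 this is the set of Hurwitz polynomials by convention;
   the value at k = 0 is not meaningful. *)
Definition weakly_hurwitz {R : realType} (k : nat) : set {poly R} :=
  if (k <= 2)%N then hurwitz k
  else [set f | pos_poly k f /\
         forall i, (2 <= i <= k - 1)%N -> lambda i f < 1].

(* For deg f = n and deg g = m with m <= n, the bound size f - size g is n - m,
   and i ranges over 0, ..., m. *)
Definition gen_hadamard {R : realType} (f g : {poly R}) : set {poly R} :=
  [set \poly_(i < size g) (f`_(j + i) * g`_i) |
    j in [set j : nat | (j <= size f - size g)%N]].

(* Main.v *)
(* For m <= 4 the Hurwitz property of a polynomial with positive coefficients is
   empty (m = 1, 2), lambda_2 < 1 (m = 3) or lambda_2 + lambda_3 < 1 (m = 4).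
   Since lambda_i(F_j) = lambda_(j+i)(f) * lambda_i(g) and the first factor is
   below 1, these conditions pass from g to F_j.  The criteria themselves come
   from splitting off a real quadratic factor s^2 + p s + q with q > 0: with
   h = a + b s + ... the cofactor, the Hurwitz determinant is p (m = 3) or p b
   (m = 4) times a positive expression. *)
Require Import Defs.
From mathcomp Require Import all_boot all_order all_algebra.
From mathcomp Require Import complex.
From mathcomp Require Import classical_sets reals.
From mathcomp Require Import ring lra.

Local Open Scope classical_set_scope.
Local Open Scope ring_scope.

Import Order.TTheory GRing.Theory Num.Theory.

Section RouthHurwitz.
Context {R : realType}.
Implicit Types (f h : {poly R}) (p q : R) (z : R[i]).

Local Notation toC := (map_poly (real_complex R)).

(** * Real quadratic factors attached to complex roots *)

Definition quad p q : {poly R} := 'X^2 + p *: 'X + q%:P.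

Lemma size_quad p q : size (quad p q) = 3.
Proof.
rewrite /quad -addrA size_polyDl size_polyXn //.
apply: (leq_ltn_trans (size_polyD _ _)); rewrite gtn_max.
rewrite (leq_ltn_trans (size_scale_leq _ _)) ?size_polyX //.
by rewrite (leq_ltn_trans (size_polyC_leq1 _)).
Qed.

Lemma coef_quadM p q h :
  [/\ (quad p q * h)`_0 = q * h`_0,
      (quad p q * h)`_1 = p * h`_0 + q * h`_1 &
      forall i, (quad p q * h)`_i.+2 = h`_i + p * h`_i.+1 + q * h`_i.+2].
Proof.
rewrite /quad !mulrDl -scalerAl mul_polyC.
by split=> [||i]; rewrite !coefD !coefZ coefXnM coefXM /= ?subn2; ring.
Qed.

Lemma real_root_toC f (r : R) : root (toC f) r%:C%C = root f r.
Proof. by rewrite fmorph_root. Qed.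

Lemma toC_quad_root p q z :
  root (toC (quad p q)) z = (z ^+ 2 + p%:C%C * z + q%:C%C == 0).
Proof.
by rewrite /root /quad !rmorphD /= map_polyXn map_polyZ map_polyX map_polyC
  !hornerE.
Qed.

(** The quadratic is [(s - z)(s - conj z)]. The remainder of [f] modulo it is real, of degree at
    most one, and vanishes at the nonreal point [z], which forces it to be zero. *)
Lemma nonreal_root_quad_dvd f z : root (toC f) z -> complex.Im z != 0 ->
  quad (- (2 * complex.Re z)) (complex.Re z ^+ 2 + complex.Im z ^+ 2) %| f.
Proof.
case: z => x y /= fz y0; set d := quad _ _.
have dz : root (toC d) (x +i* y)%C.
  rewrite toC_quad_root; apply/eqP; rewrite expr2; simpc.
  by congr (_ +i* _)%C; ring.
have : root (toC (f %% d)) (x +i* y)%C.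
  move: fz; rewrite {1}(divp_eq f d) rmorphD rmorphM /= /root hornerD hornerM.
  by rewrite (eqP dz) mulr0 add0r.
have sz : (size (f %% d)%R <= 2)%N.
  have d0 : d != 0 by rewrite -size_poly_eq0 size_quad.
  by have := ltn_modp f d; rewrite d0 size_quad.
rewrite /dvdp.
have -> : f %% d = ((f %% d)`_0)%:P + (f %% d)`_1 *: 'X.
  apply/polyP => i; rewrite coefD coefC coefZ coefX.
  case: i => [|[|i]] /=; rewrite ?mulr1 ?mulr0 ?addr0 ?add0r //.
  by rewrite nth_default // (leq_trans sz).
set a := _`_0; set b := _`_1.
rewrite /root rmorphD /= map_polyZ map_polyX map_polyC !hornerE /=; simpc.
rewrite eq_complex /= => /andP[/eqP e1 /eqP e2].
(* The imaginary part of [a + b z] is [b * y], and [y] is nonzero. *)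
have b0 : b = 0 by apply: (mulIf y0); rewrite mul0r.
move: e1; rewrite b0 ?(mul0r, mulr0, subr0, addr0, add0r) => ->.
by rewrite scale0r addr0.
Qed.

Lemma pos_poly_horner_gt0 k f (x : R) : pos_poly k f -> 0 <= x -> 0 < f.[x].
Proof.
move=> [sf f_gt0] x0; rewrite horner_coef sf big_ord_recl expr0 mulr1.
rewrite ltr_wpDr ?f_gt0 //; apply: sumr_ge0 => i _.
by rewrite mulr_ge0 ?exprn_ge0 // ltW // f_gt0 // lift0 ltn_ord.
Qed.

(** Positive coefficients exclude real roots [x >= 0], so a root in the closed right half-plane is
    nonreal and yields a factor with [p = - 2 Re z] and [q = |z|^2]. *)
Lemma unstable_quad_factor k f z : pos_poly k f -> root (toC f) z ->
  0 <= complex.Re z ->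
  exists p q h, [/\ f = quad p q * h, p <= 0 & 0 < q].
Proof.
move=> fP fz rez.
have z0 : complex.Im z != 0.
  apply: contraTneq fz; case: z rez => x y /= x0 ->.
  rewrite (_ : (x +i* 0)%C = x%:C%C) // real_root_toC.
  by rewrite /root gt_eqF // (pos_poly_horner_gt0 k).
have /dvdpP[h fE] := nonreal_root_quad_dvd _ _ fz z0.
eexists _, _, h; split; first by rewrite mulrC; exact: fE.
  by rewrite oppr_le0 mulr_ge0.
by rewrite ltr_wpDl ?sqr_ge0 // lt0r sqr_ge0 sqrf_eq0 z0.
Qed.

(** The root condition of [hurwitz] alone: unlike positivity of the coefficients, it passes to
    divisors directly. *)
Definition stable f :=
  forall z, root (toC f) z -> complex.Re z < 0.

Lemma stable_dvd f h : h %| f -> stable f -> stable h.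
Proof.
by move=> /dvdpP[q ->] fS z hz; apply: fS; rewrite rmorphM rootM hz orbT.
Qed.

Lemma stable_root f : (1 < size f)%N -> stable f ->
  (exists p q, [/\ 0 < p, 0 < q & quad p q %| f]) \/
  (exists2 r, 0 < r & ('X + r%:P) %| f).
Proof.
move=> sf fS.
have /closed_rootP[z fz] : size (toC f) != 1.
  by rewrite size_map_poly gtn_eqF.
have rez := fS _ fz.
have [z0|z0] := eqVneq (complex.Im z) 0.
  right; exists (- complex.Re z); first by rewrite oppr_gt0.
  rewrite polyCN dvdp_XsubCl -real_root_toC.
  by case: z z0 fz {rez} => x y /= ->.
left; eexists _, _; split; last exact: nonreal_root_quad_dvd fz z0.
  by rewrite oppr_gt0 pmulr_rlt0.
by rewrite ltr_wpDl ?sqr_ge0 // lt0r sqr_ge0 sqrf_eq0 z0.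
Qed.

(** A nonreal root gives the factor at once. If the root found is real, its linear factor is split
    off and the cofactor examined: either it has a quadratic factor of the required kind, or a
    second real root completes the first. *)
Lemma stable_quad_factor f : (2 < size f)%N -> stable f ->
  exists p q h, [/\ f = quad p q * h, 0 < p & 0 < q].
Proof.
move=> sf fS.
have [] := stable_root f (ltnW sf) fS.
  by move=> [p [q [p0 q0 /dvdpP[h ->]]]]; exists p, q, h; rewrite mulrC.
move=> [r r0 /dvdpP[h fE]].
have h0 : h != 0 by apply: contraTneq sf => h0; rewrite fE h0 mul0r size_poly0.
have sh : (1 < size h)%N.
  rewrite fE -[r%:P]opprK -polyCN size_Mmonic ?monicXsubC // in sf.
  by rewrite size_XsubC addn2 in sf.
have hf : h %| f by rewrite fE dvdp_mulIl.
have [] := stable_root h sh (stable_dvd _ _ hf fS).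
  move=> [p [q [p0 q0 /dvdpP[h' hE]]]]; exists p, q, (h' * ('X + r%:P)).
  by rewrite fE hE; split=> //; ring.
(* Two negative real roots combine: [(s + r)(s + r') = s^2 + (r + r') s + r r']. *)
move=> [r' r'0 /dvdpP[h' hE]]; exists (r + r'), (r * r'), h'.
rewrite addr_gt0 ?mulr_gt0 //; split=> //.
by rewrite fE hE /quad -mul_polyC polyCD polyCM; ring.
Qed.

Lemma size_quad_cofactor k p q h :
  size (quad p q * h) = k.+3 -> size h = k.+1.
Proof.
move=> s; have h0 : h != 0.
  by apply: contra_eq_neq s => ->; rewrite mulr0 size_poly0.
have q0 : quad p q != 0 by rewrite -size_poly_eq0 size_quad.
by move: s; rewrite size_mul // size_quad /= => -[].
Qed.

(** * Coefficient criteria for stability in degrees one to four *)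

Lemma hurwitz_deg1 f : pos_poly 1 f -> hurwitz 1 f.
Proof.
move=> fP; split=> // z fz; rewrite ltNge; apply/negP => rez.
have [p [q [h [fE p0 q0]]]] := unstable_quad_factor _ _ _ fP fz rez.
have [sf _] := fP.
have h0 : h != 0.
  by apply: contra_eq_neq sf => h0; rewrite fE h0 mulr0 size_poly0.
have d0 : quad p q != 0 by rewrite -size_poly_eq0 size_quad.
(* Degree count: a linear polynomial has no quadratic factor. *)
move: sf; rewrite fE size_mul // size_quad /= => -[].
by move/eqP; rewrite -size_poly_eq0 in h0; case: (size h) h0.
Qed.

Lemma hurwitz_deg2 f : pos_poly 2 f -> hurwitz 2 f.
Proof.
move=> fP; split=> // z fz; rewrite ltNge; apply/negP => rez.
have [p [q [h [fE p0 q0]]]] := unstable_quad_factor _ _ _ fP fz rez.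
have [sf f_gt0] := fP; subst f.
have sh := size_quad_cofactor _ _ _ _ sf.
have [e0 e1 e2] := coef_quadM p q h.
(* The cofactor is a constant [c]; [q c > 0] gives [c > 0], so the linear coefficient [p c] cannot
   be positive when [p <= 0]. *)
have := f_gt0 1 isT; have := f_gt0 0 isT; rewrite e0 e1.
rewrite (nth_default 0 (_ : size h <= 1)%N) ?sh //.
by rewrite mulr0 addr0 pmulr_rgt0 // => h0; rewrite pmulr_lgt0 // ltNge p0.
Qed.

(** For the cofactor [a + b s] the determinant is [p * (a * (a + p * b) + q * b^2)]. The bracket is
    positive, so the determinant has the sign of [p]. *)
Lemma hurwitz_deg3 f : pos_poly 3 f ->
  hurwitz 3 f <-> f`_0 * f`_3 < f`_1 * f`_2.
Proof.
move=> fP; have [sf f_gt0] := fP.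
have f0 := f_gt0 0 isT; have f1 := f_gt0 1 isT.
have f2 := f_gt0 2 isT; have f3 := f_gt0 3 isT.
have coefs p q h : f = quad p q * h ->
    [/\ f`_0 = q * h`_0, f`_1 = p * h`_0 + q * h`_1,
        f`_2 = h`_0 + p * h`_1 & f`_3 = h`_1].
  move=> fE; have [e0 e1 e2] := coef_quadM p q h.
  have sh : size h = 2 by apply: (size_quad_cofactor _ p q); rewrite -fE.
  rewrite fE e0 e1 !e2.
  by rewrite ![h`_(_.+2)]nth_default ?sh // !mulr0 !addr0.
split=> [[_ fS] | ineq].
  have sf3 : (2 < size f)%N by rewrite sf.
  have [p [q [h [fE p0 q0]]]] := stable_quad_factor f sf3 fS.
  have [] := coefs _ _ _ fE; set a := h`_0; set b := h`_1 => e0 e1 e2 e3.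
  have a0 : 0 < a by rewrite e0 pmulr_rgt0 in f0.
  have b0 : 0 < b by rewrite e3 in f3.
  rewrite -subr_gt0 e0 e1 e2 e3.
  have -> : (p * a + q * b) * (a + p * b) - q * a * b =
    p * (a * (a + p * b) + q * b * b) by ring.
  by rewrite !(mulr_gt0, addr_gt0).
split=> // z fz; rewrite ltNge; apply/negP => rez.
have [p [q [h [fE p0 q0]]]] := unstable_quad_factor _ _ _ fP fz rez.
have [] := coefs _ _ _ fE; set a := h`_0; set b := h`_1 => e0 e1 e2 e3.
have a0 : 0 < a by rewrite e0 pmulr_rgt0 in f0.
have b0 : 0 < b by rewrite e3 in f3.
move: ineq; rewrite -subr_gt0.
(* Here [p <= 0], so [a + p * b] is kept as the coefficient of [s^2] in [f], whose positivity is
   known. *)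
have -> : f`_1 * f`_2 - f`_0 * f`_3 = p * (a * f`_2 + q * b * b).
  by rewrite e0 e1 e2 e3; ring.
by rewrite ltNge mulr_le0_ge0 // ltW // !(mulr_gt0, addr_gt0).
Qed.

(** For the cofactor [a + b s + c s^2] the determinant is [p * b] times [(q c - a)^2] plus a product
    of two positive coefficients. What remains in each direction is the sign of [b]. *)
Lemma hurwitz_deg4 f : pos_poly 4 f ->
  hurwitz 4 f <-> f`_0 * f`_3 ^+ 2 + f`_1 ^+ 2 * f`_4 < f`_1 * f`_2 * f`_3.
Proof.
move=> fP; have [sf f_gt0] := fP.
have f0 := f_gt0 0 isT; have f1 := f_gt0 1 isT.
have f3 := f_gt0 3 isT; have f4 := f_gt0 4 isT.
have factor p q h : f = quad p q * h ->
    [/\ size h = 3, f`_0 = q * h`_0, f`_3 = h`_1 + p * h`_2, f`_4 = h`_2 &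
        f`_1 * f`_2 * f`_3 - (f`_0 * f`_3 ^+ 2 + f`_1 ^+ 2 * f`_4) =
        p * h`_1 * ((q * h`_2 - h`_0) ^+ 2 + f`_1 * f`_3)].
  move=> fE; have [e0 e1 e2] := coef_quadM p q h.
  have sh : size h = 3 by apply: (size_quad_cofactor _ p q); rewrite -fE.
  rewrite fE e0 e1 !e2.
  rewrite ![h`_(_.+3)]nth_default ?sh // !mulr0 !addr0.
  by split=> //; ring.
split=> [[_ fS] | ineq].
  have sf3 : (2 < size f)%N by rewrite sf.
  have [p [q [h [fE p0 q0]]]] := stable_quad_factor f sf3 fS.
  have [sh e0 e3 e4 eH] := factor _ _ _ fE.
  have hf : h %| f by rewrite fE dvdp_mulIr.
  (* The cofactor is itself stable, hence a constant [c > 0] times [s^2 + u s + v] with [u > 0], so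
     that [b = u c > 0]. *)
  have [u [v [h' [hE u0 v0]]]] :=
    stable_quad_factor h (eq_leq (esym sh)) (stable_dvd _ _ hf fS).
  have sh' : size h' = 1 by apply: (size_quad_cofactor _ u v); rewrite -hE.
  have [_ h1 h2] := coef_quadM u v h'.
  have b0 : 0 < h`_1.
    move: f4; rewrite e4 hE h1 h2 ![h'`_(_.+1)]nth_default ?sh' //.
    by rewrite !mulr0 !addr0; apply: mulr_gt0.
  by rewrite -subr_gt0 eH mulr_gt0 ?mulr_gt0 // ltr_wpDl ?sqr_ge0 ?mulr_gt0.
split=> // z fz; rewrite ltNge; apply/negP => rez.
have [p [q [h [fE p0 q0]]]] := unstable_quad_factor _ _ _ fP fz rez.
have [sh e0 e3 e4 eH] := factor _ _ _ fE.
(* The coefficient [b + p c] of [s^3] is positive, while [p <= 0 < c]. *)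
have b0 : 0 <= h`_1 by nra.
move: ineq; rewrite -subr_gt0 eH ltNge -mulrA mulr_le0_ge0 // mulr_ge0 //.
by rewrite addr_ge0 ?sqr_ge0 // mulr_ge0 // ltW.
Qed.

Lemma hurwitz3_lambda f : pos_poly 3 f -> hurwitz 3 f <-> lambda 2 f < 1.
Proof.
move=> fP; rewrite (hurwitz_deg3 _ fP); have [_ f_gt0] := fP.
by rewrite /lambda ltr_pdivrMr ?mulr_gt0 ?f_gt0 // mul1r [f`_2 * _]mulrC.
Qed.

Lemma hurwitz4_lambda f : pos_poly 4 f ->
  hurwitz 4 f <-> lambda 2 f + lambda 3 f < 1.
Proof.
move=> fP; rewrite (hurwitz_deg4 _ fP); have [_ f_gt0] := fP.
have f1 := f_gt0 1 isT; have f2 := f_gt0 2 isT; have f3 := f_gt0 3 isT.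
(* Division by [f_1 f_2 f_3] turns the two subtracted terms of the determinant into [lambda 2 f] and
   [lambda 3 f]. *)
have -> : lambda 2 f + lambda 3 f =
    (f`_0 * f`_3 ^+ 2 + f`_1 ^+ 2 * f`_4) / (f`_1 * f`_2 * f`_3).
  by rewrite /lambda /=; field; rewrite !gt_eqF.
by rewrite ltr_pdivrMr ?mul1r // !mulr_gt0.
Qed.

(** * The ratios [lambda] under the generalized Hadamard product *)

Lemma lambda_gt0 k f i : pos_poly k f -> (i < k)%N -> 0 < lambda i f.
Proof.
move=> [_ f_gt0] ik; rewrite /lambda divr_gt0 // mulr_gt0 // f_gt0 //.
- by rewrite (leq_trans (leq_subr _ _)) // ltnW.
- by rewrite addn1.
- exact: ltnW.
- by rewrite (leq_trans (leq_subr _ _)) // ltnW.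
Qed.

(** The bounds on [i] keep the indices [i-2] to [i+1] within the range of [\poly] and the
    subtractions exact, so the shift by [j] commutes with them and the quotient factors. *)
Lemma lambda_hadamard f (g : {poly R}) j i : (2 <= i)%N -> (i.+1 < size g)%N ->
  lambda i (\poly_(l < size g) (f`_(j + l) * g`_l)) =
  lambda (j + i) f * lambda i g.
Proof.
case: i => [|[|i]] // _ ig3; rewrite /lambda addn1 subn2 subn1 !coef_poly /=.
have ig2 := ltnW ig3; have ig1 := ltnW ig2; have ig0 := ltnW ig1.
rewrite ig0 ig1 ig2 ig3 !addnS addn0 subn2 subn1 /=.
by rewrite mulf_div mulrACA [X in _ / X = _]mulrACA.
Qed.

Lemma weakly_hurwitz_pos_poly n f : weakly_hurwitz n f -> pos_poly n f.
Proof. by rewrite /weakly_hurwitz; case: ifP => _ []. Qed.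

End RouthHurwitz.

Theorem theorem2 (R : realType) (m n : nat)
  (hm : (1 <= m <= 4)%N) (hn : (1 <= n)%N) (hmn : (m <= n)%N)
  (f g : {poly R}) (hf : weakly_hurwitz n f) (hg : hurwitz m g) :
  gen_hadamard f g `<=` hurwitz m.
Proof.
move=> F [j /= jP <-]; have fP := weakly_hurwitz_pos_poly _ _ hf.
have [sf f_gt0] := fP; have [gP _] := hg; have [sg g_gt0] := gP.
rewrite sf sg subSS in jP.
(* The window of coefficients from [j] to [j + m] stays inside [f]. *)
have jm : (j + m <= n)%N by rewrite -(subnK hmn) leq_add2r.
have FP : pos_poly m (\poly_(i < size g) (f`_(j + i) * g`_i)).
  have F_gt0 i : (i <= m)%N -> 0 < f`_(j + i) * g`_i.
    by move=> im; rewrite mulr_gt0 ?g_gt0 ?f_gt0 // (leq_trans _ jm) ?leq_add2l.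
  split=> [|i im]; first by rewrite sg size_poly_eq // gt_eqF ?F_gt0.
  by rewrite coef_poly sg ltnS im F_gt0.
have lambdaF i : (2 <= i < m)%N ->
    lambda i (\poly_(i < size g) (f`_(j + i) * g`_i)) < lambda i g.
  move=> /andP[i2 im].
  have lt_jin : (j + i < n)%N.
    by rewrite (leq_trans _ jm) // -addnS leq_add2l.
  have ji2 : (2 <= j + i)%N by rewrite (leq_trans i2) // leq_addl.
  rewrite lambda_hadamard ?sg // gtr_pMl ?(lambda_gt0 _ _ _ gP) //.
  (* Since [2 <= j + i < n], the degree [n] exceeds two and [weakly_hurwitz] unfolds to the bounds
     on [lambda], applied at the index [j + i]. *)
  move: hf; rewrite /weakly_hurwitz leqNgt (leq_ltn_trans ji2 lt_jin) /= => -[_].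
  by apply; rewrite ji2 subn1 -ltnS prednK // (leq_trans _ hmn).
move: m hm hg gP FP lambdaF {hmn jP jm sg g_gt0}.
case=> [|[|[|[|[|]]]]] // _ hg gP FP lambdaF.
- exact: hurwitz_deg1.
- exact: hurwitz_deg2.
- apply/(hurwitz3_lambda _ FP).
  by apply: lt_trans (lambdaF 2 isT) _; apply/(hurwitz3_lambda _ gP).
- apply/(hurwitz4_lambda _ FP).
  apply: lt_trans (_ : lambda 2 g + lambda 3 g < 1);
    last exact/(hurwitz4_lambda _ gP).
  by rewrite ltrD ?lambdaF.
Qed.
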